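(* Let $A$ be a semiprime Banach $f$-algebra. Let $R\colon A\to C(K)$ be a contractive and injective lattice-algebra homomorphism, for some compact Hausdorff space $K$. Suppose that every lattice-algebra homomorphism $\phi\colon A\to\mathbb{R}$ extends to a non-zero lattice-algebra homomorphism $\tilde\phi\colon C(K)\to\mathbb{R}$, in the sense that $\phi=\tilde\phi R$. Suppose also that the vector lattice algebra generated by $\{Ra : a\in A\}\cup\{\mathbb{1}\}$ is dense in $C(K)$. Then $K$ is homeomorphic to $K_A$.
   Context: All spaces are real. A vector lattice algebra is a real associative algebra that is also a vector lattice in which the product of positive elements is positive. An $f$-algebra is a vector lattice algebra such that $a\wedge b=0$ and $c\ge 0$ imply $(ac)\wedge b=0=(ca)\wedge b$. A Banach $f$-algebra is an $f$-algebra equipped with a complete, submultiplicative lattice norm. It is semiprime if $a^2=0$ implies $a=0$. A lattice-algebra homomorphism is a linear map preserving the lattice operations and the product (it may be the zero map unless stated otherwise). Contractive means of operator norm at most $1$. $C(K)$ is the space of real continuous functions on $K$ with supremum norm and pointwise order and product; $\mathbb{1}$ is the constant one function. The vector lattice algebra generated by a subset is the smallest linear subspace containing it that is closed under lattice operations and products. $K_A\subseteq A^*$ denotes the set of all functionals $A\to\mathbb{R}$ that are lattice-algebra homomorphisms (including the zero functional), equipped with the weak$^*$ topology. *)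

(* Defs.v *)
From HB Require Import structures.
From mathcomp Require Import all_boot all_order all_algebra.
From mathcomp Require Import all_classical all_reals all_analysis.

Set Implicit Arguments.
Unset Strict Implicit.
Unset Printing Implicit Defensive.

Import Order.TTheory GRing.Theory Num.Theory.
Import numFieldNormedType.Exports.

Local Open Scope classical_set_scope.
Local Open Scope ring_scope.

Reserved Notation "a <=v b" (at level 70, no associativity).
Reserved Notation "a /\v b" (at level 45, left associativity).
Reserved Notation "a \/v b" (at level 45, left associativity).
Reserved Notation "a ** b" (at level 40, left associativity).

(* The order is a field, rather than a [porderType] or [latticeType] structure,
   because Hierarchy Builder cannot join these with [normedModType] on a carrier
   that is not a [numDomainType]. The product is a field because [A] need not
   have a unit. *)
HB.mixin Record Lmodule_isVectorLatticeAlgebra (R : realType) (A : Type)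
    & GRing.Lmodule R A := {
  vle : A -> A -> Prop;
  vle_refl : forall a, vle a a;
  vle_anti : forall a b, vle a b -> vle b a -> a = b;
  vle_trans : forall b a c, vle a b -> vle b c -> vle a c;
  vle_add2r : forall c a b, vle a b -> vle (a + c) (b + c);
  vle_scale : forall (k : R) a, 0 <= k -> vle 0 a -> vle 0 (k *: a);
  vmeet : A -> A -> A;
  vmeetP : forall c a b, vle c (vmeet a b) <-> vle c a /\ vle c b;
  vjoin : A -> A -> A;
  vjoinP : forall c a b, vle (vjoin a b) c <-> vle a c /\ vle b c;
  vmul : A -> A -> A;
  vmulA : associative vmul;
  vmulDl : left_distributive vmul +%R;
  vmulDr : right_distributive vmul +%R;
  vmulZl : forall (k : R) a b, vmul (k *: a) b = k *: vmul a b;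
  vmulZr : forall (k : R) a b, vmul a (k *: b) = k *: vmul a b;
  vmul_ge0 : forall a b, vle 0 a -> vle 0 b -> vle 0 (vmul a b)
}.

#[short(type="vlaType")]
HB.structure Definition VectorLatticeAlgebra (R : realType) :=
  {A of GRing.Lmodule R A & Lmodule_isVectorLatticeAlgebra R A}.

Notation "a <=v b" := (vle a b) : ring_scope.
Notation "a /\v b" := (vmeet a b) : ring_scope.
Notation "a \/v b" := (vjoin a b) : ring_scope.
Notation "a ** b" := (vmul a b) : ring_scope.

HB.mixin Record VectorLatticeAlgebra_isFAlgebra (R : realType) (A : Type)
    & VectorLatticeAlgebra R A := {
  falg_disjoint : forall a b c : A, a /\v b = 0 -> 0 <=v c ->
    (a ** c) /\v b = 0 /\ (c ** a) /\v b = 0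
}.

#[short(type="fAlgType")]
HB.structure Definition FAlgebra (R : realType) :=
  {A of VectorLatticeAlgebra R A & VectorLatticeAlgebra_isFAlgebra R A}.

Definition vabs (R : realType) (A : vlaType R) (a : A) : A := a \/v (- a).

HB.mixin Record FAlgebra_isBanach (R : realType) (A : Type)
    & FAlgebra R A & CompleteNormedModule R A := {
  lattice_norm : forall a b : A, vabs a <=v vabs b -> `|a| <= `|b|;
  norm_submult : forall a b : A, `|a ** b| <= `|a| * `|b|
}.

#[short(type="banachFAlgType")]
HB.structure Definition BanachFAlgebra (R : realType) :=
  {A of FAlgebra R A & CompleteNormedModule R A & FAlgebra_isBanach R A}.

Definition semiprime (R : realType) (A : vlaType R) : Prop :=
  forall a : A, a ** a = 0 -> a = 0.

Definition lattice_algebra_hom (R : realType) (A B : vlaType R) (f : A -> B) :=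
  [/\ linear f,
      {morph f : a b / a /\v b},
      {morph f : a b / a \/v b} &
      {morph f : a b / a ** b}].

Definition sub_vla (R : realType) (A : vlaType R) (S : set A) : Prop :=
  [/\ S 0,
      forall (k : R) a b, S a -> S b -> S (k *: a + b),
      forall a b, S a -> S b -> S (a /\v b),
      forall a b, S a -> S b -> S (a \/v b) &
      forall a b, S a -> S b -> S (a ** b)].

Definition generated_vla (R : realType) (A : vlaType R) (G : set A) : set A :=
  smallest (@sub_vla R A) G.

(* With values in [\bar R], so that an unbounded map has norm [+oo]. *)
Definition operator_norm (R : realType) (V W : normedModType R) (f : V -> W)
  : \bar R := ereal_sup [set `|f v|%:E | v in [set v : V | `|v| <= 1]].

Definition contractive (R : realType) (V W : normedModType R) (f : V -> W) :=
  (operator_norm f <= 1)%E.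

Section real_vla.
Variable R : realType.
Implicit Types a b c k : R.

Let rle a b : Prop := a <= b.

Let rle_anti a b : rle a b -> rle b a -> a = b.
Proof. by move=> ab ba; apply/le_anti/andP. Qed.
Let rle_add2r c a b : rle a b -> rle (a + c) (b + c).
Proof. by rewrite /rle lerD2r. Qed.
Let rminP c a b : rle c (Num.min a b) <-> rle c a /\ rle c b.
Proof. by rewrite /rle le_min; split=> /andP. Qed.
Let rmaxP c a b : rle (Num.max a b) c <-> rle a c /\ rle b c.
Proof. by rewrite /rle ge_max; split=> /andP. Qed.
Let rmulZl k a b : (k *: a : R) * b = k *: (a * b).
Proof. by rewrite -mulrA. Qed.
Let rmulZr k a b : a * (k *: b : R) = k *: (a * b).
Proof. exact: mulrCA. Qed.

HB.instance Definition _ := Lmodule_isVectorLatticeAlgebra.Build R R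
  (@lexx _ R) rle_anti (@le_trans _ R) rle_add2r (@mulr_ge0 R)
  rminP rmaxP (@mulrA R) (@mulrDl R) (@mulrDr R) rmulZl rmulZr (@mulr_ge0 R).

End real_vla.

HB.mixin Record isCompactHausdorff (K : Type) & Topological K := {
  compact_axiom : compact [set: K];
  hausdorff_axiom : hausdorff_space K
}.

#[short(type="compactHausdorffType")]
HB.structure Definition CompactHausdorff :=
  {K of Topological K & isCompactHausdorff K}.

Definition C_space (R : realType) (K : compactHausdorffType) : Type :=
  continuousType K R.

Section C_space.
Variables (R : realType) (K : compactHausdorffType).
Local Notation C := (C_space R K).
Implicit Types (f g h : C) (k : R) (x : K).

HB.instance Definition _ := Choice.on C.

Definition mkC (u : K -> R) (cu : continuous u) : C :=
  HB.pack_for (continuousType K R) u (isContinuous.Build K R u cu).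

Lemma C_ext f g : (forall x, f x = g x) -> f = g.
Proof. by move=> fg; apply/continuousEP. Qed.

Lemma C_cont f : continuous (f : K -> R).
Proof. exact: cts_fun. Qed.

Definition C_cst k : C := mkC (@cst_continuous K R k).

Lemma C_add_cont f g : continuous (fun x => f x + g x).
Proof. by move=> x; apply: cvgD; exact: C_cont. Qed.
Definition C_add f g : C := mkC (@C_add_cont f g).

Lemma C_opp_cont f : continuous (fun x => - f x).
Proof. by move=> x; apply: cvgN; exact: C_cont. Qed.
Definition C_opp f : C := mkC (@C_opp_cont f).

Lemma C_mul_cont f g : continuous (fun x => f x * g x).
Proof. by move=> x; apply: cvgM; exact: C_cont. Qed.
Definition C_mul f g : C := mkC (@C_mul_cont f g).

Lemma C_scale_cont k f : continuous (fun x => k * f x).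
Proof. by move=> x; apply: cvgM; [exact: cvg_cst|exact: C_cont]. Qed.
Definition C_scale k f : C := mkC (@C_scale_cont k f).

Lemma C_min_cont f g : continuous (fun x => Num.min (f x) (g x)).
Proof. by move=> x; apply: continuous_min; exact: C_cont. Qed.
Definition C_min f g : C := mkC (@C_min_cont f g).

Lemma C_max_cont f g : continuous (fun x => Num.max (f x) (g x)).
Proof. by move=> x; apply: continuous_max; exact: C_cont. Qed.
Definition C_max f g : C := mkC (@C_max_cont f g).

Lemma C_addA : associative C_add.
Proof. by move=> f g h; apply: C_ext => x; exact: addrA. Qed.
Lemma C_addC : commutative C_add.
Proof. by move=> f g; apply: C_ext => x; exact: addrC. Qed.
Lemma C_add0 : left_id (C_cst 0) C_add.
Proof. by move=> f; apply: C_ext => x; exact: add0r. Qed.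
Lemma C_addN : left_inverse (C_cst 0) C_opp C_add.
Proof. by move=> f; apply: C_ext => x; exact: addNr. Qed.
HB.instance Definition _ := GRing.isZmodule.Build C C_addA C_addC C_add0 C_addN.

Lemma C_scaleA k l f : C_scale k (C_scale l f) = C_scale (k * l) f.
Proof. by apply: C_ext => x; exact: mulrA. Qed.
Lemma C_scale1 : left_id 1 C_scale.
Proof. by move=> f; apply: C_ext => x; exact: mul1r. Qed.
Lemma C_scaleDr : right_distributive C_scale +%R.
Proof. by move=> k f g; apply: C_ext => x; exact: mulrDr. Qed.
Lemma C_scaleDl f : {morph C_scale^~ f : k l / k + l}.
Proof. by move=> k l; apply: C_ext => x; exact: mulrDl. Qed.
HB.instance Definition _ := GRing.Zmodule_isLmodule.Build R C
  C_scaleA C_scale1 C_scaleDr C_scaleDl.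

Definition C_le f g : Prop := forall x, f x <= g x.

Lemma C_le_refl f : C_le f f.
Proof. by move=> x. Qed.
Lemma C_le_anti f g : C_le f g -> C_le g f -> f = g.
Proof. by move=> fg gf; apply: C_ext => x; apply/le_anti; rewrite fg gf. Qed.
Lemma C_le_trans g f h : C_le f g -> C_le g h -> C_le f h.
Proof. by move=> fg gh x; exact: le_trans (fg x) (gh x). Qed.
Lemma C_le_add2r h f g : C_le f g -> C_le (f + h) (g + h).
Proof. by move=> fg x; rewrite lerD2r. Qed.
Lemma C_le_scale k f : 0 <= k -> C_le 0 f -> C_le 0 (k *: f).
Proof. by move=> k0 f0 x; exact: (mulr_ge0 k0 (f0 x)). Qed.
Lemma C_minP h f g : C_le h (C_min f g) <-> C_le h f /\ C_le h g.
Proof.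
split=> [hfg|[hf hg] x]; last by rewrite le_min hf hg.
by split=> x; have := hfg x; rewrite le_min => /andP[].
Qed.
Lemma C_maxP h f g : C_le (C_max f g) h <-> C_le f h /\ C_le g h.
Proof.
split=> [fgh|[fh gh] x]; last by rewrite ge_max fh gh.
by split=> x; have := fgh x; rewrite ge_max => /andP[].
Qed.
Lemma C_mulA : associative C_mul.
Proof. by move=> f g h; apply: C_ext => x; exact: mulrA. Qed.
Lemma C_mulDl : left_distributive C_mul +%R.
Proof. by move=> f g h; apply: C_ext => x; exact: mulrDl. Qed.
Lemma C_mulDr : right_distributive C_mul +%R.
Proof. by move=> f g h; apply: C_ext => x; exact: mulrDr. Qed.
Lemma C_mulZl k f g : C_mul (k *: f) g = k *: C_mul f g.
Proof. by apply: C_ext => x; rewrite /= mulrA. Qed.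
Lemma C_mulZr k f g : C_mul f (k *: g) = k *: C_mul f g.
Proof. by apply: C_ext => x; exact: mulrCA. Qed.
Lemma C_mul_ge0 f g : C_le 0 f -> C_le 0 g -> C_le 0 (C_mul f g).
Proof. by move=> f0 g0 x; exact: (mulr_ge0 (f0 x) (g0 x)). Qed.
HB.instance Definition _ := Lmodule_isVectorLatticeAlgebra.Build R C
  C_le_refl C_le_anti C_le_trans C_le_add2r C_le_scale C_minP C_maxP
  C_mulA C_mulDl C_mulDr C_mulZl C_mulZr C_mul_ge0.

(* [sup set0 = 0], so the formula is also right for empty [K]. *)
Definition C_norm f : R := sup [set `|f x| | x in [set: K]].

Lemma C_norm_ubound f : has_ubound [set `|f x| | x in [set: K]].
Proof.
have [M [_ fM]] : bounded_set ((f : K -> R) @` [set: K]).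
  apply/compact_bounded/continuous_compact; last exact: compact_axiom.
  exact/continuous_subspaceT/C_cont.
exists (M + 1) => _ [x _ <-]; apply: (fM (M + 1)); first by rewrite ltrDl.
by exists x.
Qed.

Lemma le_C_norm f x : `|f x| <= C_norm f.
Proof. by apply: ub_le_sup; [exact: C_norm_ubound|exists x]. Qed.

Lemma C_norm_le f (M : R) : 0 <= M -> (forall x, `|f x| <= M) -> C_norm f <= M.
Proof.
move=> M0 fM; rewrite /C_norm.
have [->|ne] := eqVneq [set `|f x| | x in [set: K]] set0; first by rewrite sup0.
by apply: ge_sup; [exact/set0P|move=> _ [x _ <-]].
Qed.

Lemma C_norm_ge0 f : 0 <= C_norm f.
Proof.
rewrite /C_norm.
have [->|/set0P[_ [x _ _]]] := eqVneq [set `|f x| | x in [set: K]] set0.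
  by rewrite sup0.
exact: le_trans (le_C_norm f x).
Qed.

Lemma C_normD f g : C_norm (f + g) <= C_norm f + C_norm g.
Proof.
apply: C_norm_le => [|x]; first by rewrite addr_ge0 ?C_norm_ge0.
by apply: le_trans (ler_normD _ _) _; rewrite lerD ?le_C_norm.
Qed.

Lemma C_normZ_le k f : C_norm (k *: f) <= `|k| * C_norm f.
Proof.
apply: C_norm_le => [|x]; first by rewrite mulr_ge0 ?C_norm_ge0.
by rewrite normrM ler_wpM2l ?le_C_norm.
Qed.

Lemma C_normZ k f : C_norm (k *: f) = `|k| * C_norm f.
Proof.
apply/le_anti; rewrite C_normZ_le /=.
have [->|k0] := eqVneq k 0; first by rewrite normr0 mul0r C_norm_ge0.
rewrite -ler_pdivlMl ?normr_gt0// -normfV.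
by rewrite -[f in leLHS](scalerK k0) C_normZ_le.
Qed.

Lemma C_norm0_eq0 f : C_norm f = 0 -> f = 0.
Proof.
move=> f0; apply: C_ext => x; apply/normr0_eq0/le_anti.
by rewrite normr_ge0 andbT -f0 le_C_norm.
Qed.

HB.instance Definition _ := Lmodule_isNormed.Build R C
  C_normD C_normZ C_norm0_eq0.

End C_space.

Definition C_one (R : realType) (K : compactHausdorffType) : C_space R K :=
  C_cst K 1.

(* The topology of [{ptws V -> R}], pointwise convergence, induces the weak*
   topology on the dual. *)
Definition dual (R : realType) (V : normedModType R) : set {ptws V -> R} :=
  [set phi | linear (phi : V -> R) /\ continuous (phi : V -> R)].
Arguments dual {R} V.

Definition hom_dual (R : realType) (A : banachFAlgType R) : set {ptws A -> R} :=
  dual A `&` [set phi | lattice_algebra_hom (phi : A -> R)].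
Arguments hom_dual {R} A.

(* [set_type] carries the subspace topology. *)
Definition K_space (R : realType) (A : banachFAlgType R) : topologicalType :=
  set_type (hom_dual A).

Definition homeomorphic (X Y : topologicalType) : Prop :=
  exists (f : X -> Y) (g : Y -> X),
    [/\ cancel f g, cancel g f, continuous f & continuous g].

(* Main.v *)
Require Import Defs.
From mathcomp Require Import all_boot all_order all_algebra.
From mathcomp Require Import all_classical all_reals all_analysis.
Import Order.TTheory GRing.Theory Num.Theory.
Import numFieldNormedType.Exports.
Local Open Scope classical_set_scope.
Local Open Scope ring_scope.

(** The map in question sends [x] to the functional [a |-> T a x], evaluation
    at [x] composed with [T].  It is a continuous map from a compact space to a
    Hausdorff space, so it is a homeomorphism as soon as it is bijective
    ([compact_hausdorff_homeomorphic]).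

    It is injective because two points that [T] does not tell apart are not
    told apart by the algebra generated by the range of [T] and the constants
    either, and by density not by any continuous function, contradicting
    Urysohn's lemma ([dense_generated_separates]).

    It is surjective because a homomorphism [phi] on [A] extends to a non-zero
    homomorphism on C(K), and the latter is evaluation at a point
    ([C_hom_eval]): its kernel contains no invertible function, so each
    function of the kernel has a zero, and by compactness the functions of the
    kernel have a common zero.  The extension being non-zero matters even for
    [phi = 0]: it yields a point of [K] where the whole range of [T]
    vanishes. *)

(** * Maps between normed spaces and between vector lattice algebras *)

Lemma linear_nonexpansive_continuous {R : realType} {V W : normedModType R}
    {f : V -> W} :
  linear f -> (forall v, `|f v| <= `|v|) -> continuous f.
Proof.
move=> flin fle v; apply/cvgrPdist_lt => e e0; near=> w.
have -> : f v - f w = f (v - w).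
  by rewrite -scaleN1r addrC -flin scaleN1r addrC.
apply: le_lt_trans (fle _) _.
by near: w; apply: cvgr_dist_lt.
Unshelve. all: by end_near. Qed.

Lemma contractive_norm_le {R : realType} {V W : normedModType R} {f : V -> W} :
  linear f -> contractive f -> forall v, `|f v| <= `|v|.
Proof.
move=> flin fc v.
have fZ k w : f (k *: w) = k *: f w.
  have f0 : f 0 = 0.
    have := flin 1 0 0; rewrite !scale1r addr0 => /eqP.
    by rewrite -subr_eq0 opprD addrA subrr sub0r oppr_eq0 => /eqP.
  by have := flin k w 0; rewrite addr0 f0 addr0.
have [->|v0] := eqVneq v 0.
  by have := fZ 0 0; rewrite !scale0r => ->; rewrite !normr0.
have nv : 0 < `|v| by rewrite normr_gt0.
have : `|f (`|v|^-1 *: v)| <= 1.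
  rewrite -lee_fin; apply: le_trans fc; apply: ereal_sup_ubound.
  exists (`|v|^-1 *: v) => //=.
  by rewrite normrZ normfV normr_id mulVf// gt_eqF.
by rewrite fZ normrZ normfV normr_id ler_pdivrMl// mulr1.
Qed.

Lemma lattice_algebra_hom_comp {R : realType} {A B C : vlaType R}
    {f : A -> B} {g : B -> C} :
  lattice_algebra_hom f -> lattice_algebra_hom g ->
  lattice_algebra_hom (g \o f).
Proof.
move=> [fl fm fj fp] [gl gm gj gp]; split=> /=.
- by move=> k a b; rewrite /= fl gl.
- by move=> a b; rewrite /= fm gm.
- by move=> a b; rewrite /= fj gj.
- by move=> a b; rewrite /= fp gp.
Qed.

(** * Topology *)

(** If [p] and [q] have no disjoint neighbourhoods then, by continuity, neither
    have [f i p] and [f i q], which are therefore equal for every [i]. *)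
Lemma separating_hausdorff {I : Type} {X Y : topologicalType}
    (f : I -> X -> Y) :
  hausdorff_space Y -> (forall i, continuous (f i)) ->
  (forall p q, (forall i, f i p = f i q) -> p = q) -> hausdorff_space X.
Proof.
move=> hY cf sep p q pq; apply: sep => i; apply: hY => U V Up Vq.
have [z [Uz Vz]] := pq _ _ (cf i p _ Up) (cf i q _ Vq).
by exists (f i z).
Qed.

(** The image of a closed set is compact, hence closed, and it is also the
    preimage of that set under the inverse of [f]. *)
Lemma compact_hausdorff_homeomorphic {X Y : topologicalType} {f : X -> Y} :
  compact [set: X] -> hausdorff_space Y -> continuous f ->
  injective f -> (forall y, exists x, f x = y) -> homeomorphic X Y.
Proof.
move=> cX hY cf injf surjf.
pose g y := projT1 (cid (surjf y)).
have gK : cancel g f by move=> y; rewrite /g; case: cid.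
have fK : cancel f g by move=> x; exact: injf.
exists f, g; split=> //; apply/continuous_closedP => D clD.
have -> : g @^-1` D = f @` D.
  apply/seteqP; split=> [y Dy|_ [x Dx <-]]; first by exists (g y).
  by rewrite /= fK.
apply: compact_closed => //; apply: continuous_compact.
  exact: continuous_subspaceT.
exact: subclosed_compact clD cX _.
Qed.

(** The topology of pointwise convergence is separated by the evaluations at
    the elements of [A]. *)
Lemma K_space_hausdorff {R : realType} (A : banachFAlgType R) :
  hausdorff_space (K_space A).
Proof.
apply: (separating_hausdorff (Y := R)
  (fun a (p : K_space A) => set_val p a)).
- exact: Rhausdorff.
- move=> a p.
  apply: (@continuous_comp (K_space A) {ptws A -> R} R set_val (proj a)).
    exact: initial_continuous.
  exact: proj_continuous.
- by move=> p q pq; apply: val_inj; apply: funext => a; exact: pq.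
Qed.

(** * Points of [K] and homomorphisms on C(K) *)

Section evaluation.
Context {R : realType} {K : compactHausdorffType}.
Local Notation C := (C_space R K).

Definition C_eval (x : K) (f : C) : R := f x.

Lemma C_eval_hom (x : K) : lattice_algebra_hom (C_eval x).
Proof. by split. Qed.

Lemma C_eval_continuous (x : K) : continuous (C_eval x).
Proof.
apply: linear_nonexpansive_continuous; first by have [] := C_eval_hom x.
by move=> f; exact: le_C_norm.
Qed.

Lemma C_separates (x y : K) : (forall f : C, f x = f y) -> x = y.
Proof.
move=> xy; apply/eqP/negPn/negP => /eqP nxy.
have hK := @hausdorff_axiom K.
have xsep : uniform_separator [set x] [set y].
  apply: (@normal_completely_regular R K).
  - exact: compact_normal hK (@compact_axiom K).
  - exact: hausdorff_accessible.
  - exact/accessible_closed_set1/hausdorff_accessible.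
  - exact: nxy.
pose u : C := mkC (@Urysohn_continuous K R [set x] [set y]).
have ux : u x = 0 by apply: (Urysohn_sub0 xsep); exists x.
have uy : u y = 1 by apply: (Urysohn_sub1 xsep); exists y.
by have /eqP := xy u; rewrite ux uy eq_sym oner_eq0.
Qed.

(** The functions that agree at [x] and [y] form a vector lattice subalgebra,
    and the functions that do not agree there form an open set.  The latter
    would meet the generated algebra if it were non-empty. *)
Lemma dense_generated_separates (G : set C) (x y : K) :
  dense (generated_vla G) -> (forall g, G g -> g x = g y) -> x = y.
Proof.
move=> G_dense Gxy; apply: C_separates => f; apply: contrapT => /eqP fxy.
pose O : set C := [set h | h x != h y].
have [||h []] := G_dense O; first by exists f.
- have -> : O = (fun h => C_eval x h - C_eval y h) @^-1` [set r | r != 0].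
    by apply/seteqP; split=> h; rewrite /O /= subr_eq0.
  apply: open_comp; last exact: open_neq.
  by move=> h _; exact: (cvgB (C_eval_continuous x h) (C_eval_continuous y h)).
- move=> /eqP hxy gen_h; apply: hxy; apply: (gen_h [set h | h x = h y]).
  split=> //; split=> //=.
  + by move=> k u v /= -> ->.
  + by move=> u v /= -> ->.
  + by move=> u v /= -> ->.
  + by move=> u v /= -> ->.
Qed.

(** A function without zeros is invertible in C(K), so a multiplicative map
    vanishing at it vanishes at the constant one. *)
Lemma C_zero_of_kernel {psi : C -> R} {g : C} :
  {morph psi : f h / f ** h >-> f * h} -> psi (C_one R K) != 0 -> psi g = 0 ->
  exists x, g x = 0.
Proof.
move=> psiM psi1 psig; apply: contrapT => /forallNP g0.
have cV : continuous (fun x => (g x)^-1).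
  by move=> x; apply: cvgV; [exact/eqP/g0|exact: C_cont].
have g1 : g ** mkC cV = C_one R K.
  by apply: C_ext => x; rewrite /= mulfV//; exact/eqP/g0.
by move: psi1; rewrite -g1 psiM psig mul0r eqxx.
Qed.

(** A common zero [x] of the kernel does it, since [f - psi f] lies in the
    kernel.  To find it, note that for [g] and [h] in the kernel [g ^ 2 + h ^ 2]
    is in the kernel too, and its zeros are those common to [g] and [h].  The
    kernel contains no invertible function, so these zeros exist.  Hence the
    zero sets of the functions of the kernel are a base of a proper filter,
    and a cluster point of this filter lies in all these closed sets. *)
Lemma C_hom_eval {psi : C -> R} :
  linear psi -> {morph psi : f h / f ** h >-> f * h} -> (exists f, psi f <> 0) ->
  exists x, forall f, psi f = f x.
Proof.
move=> psil psiM [f0 psif0].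
have psi1 : psi (C_one R K) = 1.
  have : psi (f0 ** C_one R K) = psi f0.
    by congr (psi _); apply: C_ext => x; exact: mulr1.
  rewrite psiM -[in RHS](mulr1 (psi f0)).
  by move=> /mulfI; apply; exact/eqP.
have psi0 : psi 0 = 0.
  have := psil (-1) 0 0; rewrite scaler0 addr0 => ->.
  by rewrite scaleN1r addNr.
pose Z (g : C) := [set x | g x = 0].
pose ker : set C := [set g | psi g = 0].
have kerD g h : ker g -> ker h -> ker (g ** g + h ** h).
  rewrite /ker /= => pg ph; rewrite -[g ** g]scale1r psil !psiM pg ph.
  by rewrite !mulr0 scaler0 addr0.
have FF : ProperFilter (filter_from ker Z).
  apply: filter_from_proper.
    apply: filter_from_filter; first by exists 0.
    move=> g h kg kh; exists (g ** g + h ** h); first exact: kerD.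
    move=> x; rewrite /Z /= => /eqP.
    rewrite -!expr2 paddr_eq0 ?sqr_ge0// !sqrf_eq0.
    by move=> /andP[/eqP gx /eqP hx]; split.
  move=> g kg; apply: (C_zero_of_kernel (psi := psi)) => //.
  by rewrite psi1 oner_neq0.
have [|x [_ clx]] := @compact_axiom K _ FF; first exact: filterT.
have ker0 g : ker g -> g x = 0.
  move=> kg; have clZ : closed (Z g).
    apply: (@closed_comp K R g [set r | r = 0]); last exact: closed_eq.
    by move=> y _; exact: C_cont.
  apply: clZ => U Ux.
  by apply: clx Ux; exists g.
exists x => f.
have : ker ((- psi f) *: C_one R K + f).
  by rewrite /ker /= psil psi1 -[_ *: _]/(- psi f * 1) mulr1 addNr.
by move=> /ker0/eqP; rewrite addrC /= mulr1 subr_eq0 => /eqP.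
Qed.

End evaluation.

Theorem proposition3p13 (R : realType) (A : banachFAlgType R)
    (K : compactHausdorffType) (T : A -> C_space R K)
    (A_semiprime : semiprime A)
    (T_hom : lattice_algebra_hom T)
    (T_contractive : contractive T)
    (T_injective : injective T)
    (T_extend : forall phi : A -> R, lattice_algebra_hom phi ->
      exists psi : C_space R K -> R,
        [/\ lattice_algebra_hom psi, exists f, psi f <> 0 &
            forall a, phi a = psi (T a)])
    (T_dense : dense (generated_vla (range T `|` [set C_one R K]))) :
  homeomorphic K (K_space A).
Proof.
have [T_lin _ _ _] := T_hom.
pose ev (x : K) : {ptws A -> R} := fun a => T a x.
have ev_hom x : lattice_algebra_hom (ev x : A -> R).
  exact: (lattice_algebra_hom_comp T_hom (C_eval_hom x)).
have ev_in x : hom_dual A (ev x).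
  split; last exact: ev_hom.
  have [ev_lin _ _ _] := ev_hom x.
  split; first exact: ev_lin.
  apply: linear_nonexpansive_continuous; first exact: ev_lin.
  move=> a; apply: le_trans (contractive_norm_le T_lin T_contractive a).
  exact: le_C_norm.
pose hat x : K_space A := SigSub (mem_set (ev_in x)).
apply: (compact_hausdorff_homeomorphic (f := hat)).
- exact: compact_axiom.
- exact: K_space_hausdorff.
- by apply: continuous_comp_initial => x; apply/pointwise_cvgP => a; exact: C_cont.
- move=> x y /(congr1 val) xy; apply: dense_generated_separates T_dense _.
  by move=> _ [[a _ <-]|->] //; exact: (congr1 (@^~ a) xy).
- move=> p; have [_ phom] := set_mem (valP p).
  have [psi [[psil _ _ psiM] psin0 psiT]] := T_extend _ phom.
  have [x psix] := C_hom_eval psil psiM psin0.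
  exists x; apply: val_inj; apply: funext => a.
  by rewrite /= psiT psix.
Qed.
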